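(* For any ordinal $\alpha\in[1,\omega_1)$ and any $p\in[1,+\infty)$ there exists an $\mathcal S$-open set $E$ in $\ell_p$ such that $E$ belongs to the $\alpha$'th additive class and does not belong to the $\alpha$'th multiplicative class in $\ell_p$.
   Context: $\ell_p$ is the space of all real sequences $x=(x_n)_{n=1}^\infty$ with $\sum_{n=1}^\infty|x_n|^p<\infty$, with the topology of the norm $\|x\|_p=(\sum_{n=1}^\infty|x_n|^p)^{1/p}$. A set $E\subseteq\ell_p$ is $\mathcal S$-open if for every $x\in E$, every sequence $y$ that differs from $x$ in at most one coordinate belongs to $E$. Additive and multiplicative Borel classes of subsets of $\ell_p$: the additive class $0$ consists of the open sets and the multiplicative class $0$ of the closed sets; for $1\le\alpha<\omega_1$ a set is of additive class $\alpha$ if it is a countable union of sets each of which is of some multiplicative class $\beta<\alpha$, and of multiplicative class $\alpha$ if it is a countable intersection of sets each of which is of some additive class $\beta<\alpha$. In particular the additive class $1$ is the class of $F_\sigma$-sets and the multiplicative class $1$ is the class of $G_\delta$-sets. *)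

(* Defs.v *)
From HB Require Import structures.
From mathcomp Require Import all_boot all_order all_algebra.
From mathcomp Require Import all_classical all_reals all_analysis.

Set Implicit Arguments.
Unset Strict Implicit.
Unset Printing Implicit Defensive.

Import Order.TTheory GRing.Theory Num.Theory.
Import numFieldNormedType.Exports.

Local Open Scope classical_set_scope.
Local Open Scope ring_scope.

Definition psum (R : realType) (p : R) (x : nat -> R) : \bar R :=
  (\sum_(n <oo) (`|x n| `^ p)%:E)%E.

Definition psummable (R : realType) (p : R) : {pred nat -> R} :=
  mem [set x | (psum p x < +oo)%E].

Record lp (R : realType) (p : R) (p1 : 1 <= p) := Lp {
  lp_seq :> nat -> R ;
  lp_psummable : lp_seq \in psummable p }.

Definition lp_norm (R : realType) (p : R) (p1 : 1 <= p) (x : lp p1) : R :=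
  fine (psum p x) `^ p^-1.

Section lp_lmodule.
Context (R : realType) (p : R) (p1 : 1 <= p).
Implicit Types x y : nat -> R.

HB.instance Definition _ := [isSub for @lp_seq R p p1].
HB.instance Definition _ := [Choice of lp p1 by <:].

Let p_gt0 : 0 < p. Proof. exact: lt_le_trans p1. Qed.

Lemma psum_ge0 x : (0 <= psum p x)%E.
Proof. by apply: nneseries_ge0 => n _ _; rewrite lee_fin powR_ge0. Qed.

Lemma Lnorm_psum x : ('N[counting]_p%:E[EFin \o x] = psum p x `^ p^-1)%E.
Proof. by rewrite Lnorm_counting. Qed.

Lemma psummableE x :
  (x \in psummable p) = ('N[counting]_p%:E[EFin \o x] < +oo)%E.
Proof.
rewrite Lnorm_psum; apply/idP/idP => [/set_mem/= h|h]; first exact: poweR_lty.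
apply/mem_set => /=; apply: (@lty_poweRy _ _ p^-1) => //.
by rewrite invr_eq0 gt_eqF.
Qed.

Lemma psumZ a x : (psum p (a *: x) = (`|a| `^ p)%:E * psum p x)%E.
Proof.
rewrite /psum -nneseriesZl; last by move=> n _; rewrite lee_fin powR_ge0.
by apply: eq_eseriesr => n _; rewrite normrM powRM// EFinM.
Qed.

Lemma psummable_submod : submod_closed (psummable (R := R) p).
Proof.
split=> [|a x y xp yp].
  apply/mem_set => /=; rewrite /psum eseries0 => [|n _ _]; first exact: ltry.
  by rewrite normr0 powR0 ?gt_eqF.
have axp : a *: x \in psummable p.
  apply/mem_set => /=; rewrite psumZ lte_mul_pinfty ?lee_fin ?powR_ge0//.
  exact: (set_mem xp).
rewrite psummableE; apply: le_lt_trans (eminkowski _ _ _ _) _ => //.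
by rewrite lte_add_pinfty// -psummableE.
Qed.

HB.instance Definition _ :=
  GRing.isSubmodClosed.Build R (nat -> R) (psummable p) psummable_submod.
HB.instance Definition _ := [SubChoice_isSubLmodule of lp p1 by <:].

End lp_lmodule.

Section lp_normed.
Context (R : realType) (p : R) (p1 : 1 <= p).
Implicit Types x y : lp p1.

Let p_gt0 : 0 < p. Proof. exact: lt_le_trans p1. Qed.

Lemma psum_fin_num x : psum p x \is a fin_num.
Proof. by rewrite ge0_fin_numE ?psum_ge0//; exact: (set_mem (lp_psummable x)). Qed.

Lemma EFin_lp_norm x : (lp_norm x)%:E = ('N[counting]_p%:E[EFin \o x])%E.
Proof. by rewrite Lnorm_psum// -poweR_EFin fineK ?psum_fin_num. Qed.

Lemma ler_lp_normD x y : lp_norm (x + y) <= lp_norm x + lp_norm y.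
Proof.
have : lp_seq (x + y) = lp_seq x \+ lp_seq y by [].
move: (x + y) => z zE.
move: (EFin_lp_norm x) (EFin_lp_norm y) (EFin_lp_norm z); rewrite zE.
move: (lp_norm x) (lp_norm y) (lp_norm z) => a b c Ea Eb Ec.
rewrite -lee_fin EFinD Ea Eb Ec.
exact: (@eminkowski _ _ _ _ (lp_seq x) (lp_seq y) p%:E).
Qed.

Lemma lp_normZ a x : lp_norm (a *: x) = `|a| * lp_norm x.
Proof.
have : lp_seq (a *: x) = a *: lp_seq x by [].
move: (a *: x) => z zE.
rewrite /lp_norm zE psumZ// fineM ?psum_fin_num//= powRM ?powR_ge0//.
  by rewrite -powRrM mulfV ?gt_eqF// powRr1.
by rewrite fine_ge0 ?psum_ge0.
Qed.

Lemma lp_norm0_eq0 x : lp_norm x = 0 -> x = 0.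
Proof.
move=> /powR_eq0_eq0 x0; apply/val_inj/funext => n /=.
have {}x0 : psum p x = 0%E by rewrite -(fineK (psum_fin_num x)) x0.
have h : ((`|x n| `^ p)%:E <= psum p x)%E.
  apply: (@le_trans _ _ (\sum_(0 <= i < n.+1) (`|x i| `^ p)%:E)%E).
    rewrite big_nat_recr//=; apply: leeDr; apply: sume_ge0 => k _.
    by rewrite lee_fin powR_ge0.
  by apply: nneseries_lim_ge => k _ _; rewrite lee_fin powR_ge0.
have /powR_eq0_eq0 : `|x n| `^ p = 0.
  by move: h; rewrite x0 lee_fin => h; apply/eqP; rewrite eq_le h powR_ge0.
exact: normr0_eq0.
Qed.

HB.instance Definition _ :=
  Lmodule_isNormed.Build R (lp p1) ler_lp_normD lp_normZ lp_norm0_eq0.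

End lp_normed.

Lemma psummable_eq_except (R : realType) (p : R) (p1 : 1 <= p) (x y : nat -> R)
    n : x \in psummable p -> (forall m, m != n -> y m = x m) ->
  y \in psummable p.
Proof.
move=> xp yx; have p_gt0 : 0 < p by exact: lt_le_trans p1.
have -> : y = (y - x) + 1 *: x by rewrite scale1r subrK.
rewrite addrC; apply: (psummable_submod p1).2 => //.
apply/mem_set => /=.
rewrite /psum (nneseries_split 0 n.+1); last first.
  by move=> k _; rewrite lee_fin powR_ge0.
rewrite add0n [X in (_ + X)%E]eseries0; last first.
  move=> k nk _; rewrite (_ : (y - x) k = 0) ?normr0 ?powR0 ?gt_eqF//.
  by rewrite -[LHS]/(y k - x k) yx ?subrr// gt_eqF.
by rewrite adde0 sumEFin ltry.
Qed.

(* That y ranges over lp p1 and not over all sequences is no restriction, by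
   psummable_eq_except. *)
Definition S_open (R : realType) (p : R) (p1 : 1 <= p) (E : set (lp p1)) :=
  forall x y : lp p1, E x -> (exists n, forall m, m != n -> y m = x m) -> E y.

(* The index of a class is an element a of a well-order W; it stands for the
   order type of {b | b < a}, so the least element of W stands for 0.  The
   constructors for nonzero indices require b n < a for every n, and so do not
   apply to the least element. *)
Inductive additive_class (T : topologicalType) (d : Order.disp_t)
    (W : orderType d) : W -> set T -> Prop :=
| additive_class0 a E :
    (forall b, ~~ (b < a)%O) -> open E -> additive_class a E
| additive_classS a (b : nat -> W) (F : nat -> set T) :
    (forall n, (b n < a)%O) -> (forall n, multiplicative_class (b n) (F n)) ->
    additive_class a (\bigcup_n F n)
with multiplicative_class (T : topologicalType) (d : Order.disp_t)
    (W : orderType d) : W -> set T -> Prop :=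
| multiplicative_class0 a E :
    (forall b, ~~ (b < a)%O) -> closed E -> multiplicative_class a E
| multiplicative_classS a (b : nat -> W) (F : nat -> set T) :
    (forall n, (b n < a)%O) -> (forall n, additive_class (b n) (F n)) ->
    multiplicative_class a (\bigcap_n F n).

(* Main.v *)
(* Let [code_point] send z : nat -> bool to the sequence whose m-th term is
   2^-(m+1) or 0 according to the digit [z (digit m)], where each digit is
   repeated infinitely often.  Then z can be recovered from any tail of its
   image, continuously on the closed set [code_tail n] of the sequences that
   agree with some [code_point z] from n on.  For each countable b one codes the
   additive-b traces on the image of [code_point] by elements of nat -> bool,
   through a relation [U] whose pullbacks to the sets [code_tail n] are again of
   class b.  The set of all x that eventually agree with [code_point z] for some
   z with [U z z] is invariant under finite changes and of additive class b, and
   by diagonalization its complement is not of additive class b. *)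
Require Import Defs.
From mathcomp Require Import all_boot all_order all_algebra.
From mathcomp Require Import all_classical all_reals all_analysis.
Import Order.TTheory GRing.Theory Num.Theory.
Import numFieldNormedType.Exports.
Local Open Scope classical_set_scope.
Local Open Scope ring_scope.

Set Implicit Arguments.
Unset Strict Implicit.
Unset Printing Implicit Defensive.

(** * Borel classes under complements, countable unions and countable intersections *)

Lemma additive_classC (T : topologicalType) (d : Order.disp_t)
    (W : orderType d) (a : W) (E : set T) :
  additive_class a E -> multiplicative_class a (~` E)
with multiplicative_classC (T : topologicalType) (d : Order.disp_t)
    (W : orderType d) (a : W) (E : set T) :
  multiplicative_class a E -> additive_class a (~` E).
Proof.
- case=> {a E} [a E a0 oE|a b F ba mF].
    by apply: multiplicative_class0 => //; rewrite closedC.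
  rewrite setC_bigcup; apply: (multiplicative_classS ba) => n.
  exact: multiplicative_classC.
- case=> {a E} [a E a0 cE|a b F ba aF].
    by apply: additive_class0 => //; rewrite openC.
  rewrite setC_bigcap; apply: (additive_classS ba) => n.
  exact: additive_classC.
Qed.

Section CountableUnions.
Context (d : Order.disp_t) (W : orderType d).
Hypothesis W_wf : well_founded (fun b c : W => (b < c)%O).
Context (T : topologicalType).

(** Open and closed sets enter the hierarchy only at the least index, so using them below [a]
    requires exhibiting that index. *)
Lemma below_minimal (a : W) : (exists b, (b < a)%O) ->
  exists2 b, (b < a)%O & forall c, ~~ (c < b)%O.
Proof.
move=> [b]; elim/(well_founded_ind W_wf): b => b IH ba.
have [[c cb]|nb] := pselect (exists c, (c < b)%O).
  exact: IH cb (lt_trans cb ba).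
by exists b => // c; apply/negP => cb; apply: nb; exists c.
Qed.

Lemma multiplicative_class_set0 (a : W) :
  multiplicative_class a (set0 : set T).
Proof.
have [/below_minimal[b ba b0]|na] := pselect (exists b, (b < a)%O).
  rewrite -(@bigcap_const T nat setT set0); last by exists 0%N.
  apply: (@multiplicative_classS _ _ _ a (fun=> b)) => // _.
  by apply: additive_class0 => //; exact: open0.
apply: multiplicative_class0; last exact: closed0.
by move=> b; apply/negP => ba; apply: na; exists b.
Qed.

Lemma additive_class_bigcup_lt (I : countType) (D : set I) (F : I -> set T)
    (a : W) : (exists b, (b < a)%O) ->
  (forall i, D i -> exists2 b, (b < a)%O & multiplicative_class b (F i)) ->
  additive_class a (\bigcup_(i in D) F i).
Proof.
move=> /below_minimal[b0 b0a b0min] mF.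
have /choice[b /= bP] : forall i, exists b, (b < a)%O /\
    (D i -> multiplicative_class b (F i)).
  move=> i; have [/mF[b ba bF]|nDi] := pselect (D i); first by exists b.
  by exists b0.
(* Numbers that name no element of [D] contribute the empty set, which is of every multiplicative
   class. *)
pose b' n := if unpickle n is Some i then b i else b0.
pose F' n := if unpickle n is Some i then [set x | D i /\ F i x] else set0.
have -> : \bigcup_(i in D) F i = \bigcup_n F' n.
  apply/seteqP; split => x; last first.
    by move=> [n _]; rewrite /F'; case: unpickle => //= i [Di Fix]; exists i.
  by move=> [i Di Fix]; exists (pickle i) => //; rewrite /F' pickleK.
apply: (@additive_classS _ _ _ _ b') => n; rewrite /b' /F'.
  by case: unpickle => // i; case: (bP i).
case: unpickle => [i|]; last exact: multiplicative_class_set0.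
have [Di|nDi] := pselect (D i).
  rewrite (_ : [set x | _] = F i); first exact: (bP i).2.
  by apply/seteqP; split => x //= [].
rewrite (_ : [set x | _] = set0); first exact: multiplicative_class_set0.
by apply/seteqP; split => x //= [].
Qed.

Lemma multiplicative_class_bigcap_lt (I : countType) (D : set I)
    (F : I -> set T) (a : W) : (exists b, (b < a)%O) ->
  (forall i, D i -> exists2 b, (b < a)%O & additive_class b (F i)) ->
  multiplicative_class a (\bigcap_(i in D) F i).
Proof.
move=> a0 aF; rewrite -(setCK (\bigcap_(_ in _) _)); apply: additive_classC.
rewrite setC_bigcap; apply: additive_class_bigcup_lt => // i /aF[b ba bF].
by exists b => //; exact: additive_classC.
Qed.

Lemma additive_class_bigcup (a : W) (F : nat -> set T) :
  (exists b, (b < a)%O) -> (forall n, additive_class a (F n)) ->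
  additive_class a (\bigcup_n F n).
Proof.
move=> a0 aF.
have /choice[G GP] : forall n, exists G : nat -> set T, F n = \bigcup_k G k /\
    forall k, exists2 b, (b < a)%O & multiplicative_class b (G k).
  move=> n; have := aF n; set E := F n => aE.
  case: aE a0 => [c E' c0 _ [b bc]|c b G bc mG _].
    by have := c0 b; rewrite bc.
  by exists G; split => // k; exists (b k).
have -> : \bigcup_n F n = \bigcup_(i in [set: nat * nat]) G i.1 i.2.
  apply/seteqP; split => x [].
    by move=> n _; rewrite (GP n).1 => -[k _ Gx]; exists (n, k).
  by move=> [n k] _ Gx; exists n => //; rewrite (GP n).1; exists k.
by apply: additive_class_bigcup_lt => // -[n k] _; exact: (GP n).2.
Qed.

End CountableUnions.

(** * Universal relations for the additive classes, and diagonalization *)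

Section Universal.
Context (d : Order.disp_t) (W : orderType d).
Hypothesis W_wf : well_founded (fun b c : W => (b < c)%O).
(** Abstract form of the coding: [f] stands for [code_point], [C n] for [code_tail n], [g n] for
    [decode n]. [f_continuous] is continuity for the product topology, stated with finite
    prefixes. *)
Context (T : topologicalType) (f : (nat -> bool) -> T).
Context (C : nat -> set T) (g : nat -> T -> nat -> bool).
Hypothesis f_continuous : forall (A : set T) z, open A -> A (f z) ->
  exists N, forall z', mkseq z' N = mkseq z N -> A (f z').
Hypothesis C_Gdelta : forall n, exists2 V : nat -> set T,
  forall j, open (V j) & C n = \bigcap_j V j.
Hypothesis closed_g : forall n i v, closed [set x | C n x /\ g n x i = v].

(* [U c] is the set with code [c]; since codes are decoded from points of [C n]
   by [g n], the reindexing [phi] extracts subcodes. *)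
Definition universal_at (b : W) (U : (nat -> bool) -> (nat -> bool) -> Prop) :=
  [/\ forall A, additive_class b A -> exists c, forall z, A (f z) <-> U c z,
      forall n phi, multiplicative_class b
        [set x | C n x /\ ~ U (fun i => g n x (phi i)) (g n x)] &
      (exists b', (b' < b)%O) -> forall n phi, additive_class b
        [set x | C n x /\ U (fun i => g n x (phi i)) (g n x)] ].

Let closed_C n : closed (C n).
Proof.
rewrite (_ : C n = [set x | C n x /\ g n x 0%N = true] `|`
                   [set x | C n x /\ g n x 0%N = false]).
  by apply: closedU; exact: closed_g.
apply/seteqP; split => x /=; last by case=> -[].
by case: (g n x 0%N) => ?; [left|right].
Qed.

(** A code lists finite words and stands for the union of their cylinders; by [f_continuous] every
    open trace is such a union. The last clause is vacuous at the least index. *)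
Lemma universal_at_minimal (b : W) : (forall c, ~~ (c < b)%O) ->
  universal_at b (fun c z => exists N, c (pickle (mkseq z N))).
Proof.
move=> b0; split=> [A|n phi|[c cb]]; last by have := b0 c; rewrite cb.
- move=> addA; have {addA} oA : open A.
    by case: addA b0 => // a c F ca _ /(_ (c 0%N)); rewrite ca.
  (* The code lists the words whose whole cylinder is sent into [A]. *)
  exists (fun k => `[< forall z N, k = pickle (mkseq z N) -> A (f z) >]) => z.
  split=> [Az|[N /asboolP]]; last exact.
  have [N zN] := f_continuous oA Az.
  exists N; apply/asboolP => z' N' /(pcan_inj pickleK) e; apply: zN.
  by move: (congr1 size e); rewrite !size_mkseq => NN'; rewrite e NN'.
- apply: multiplicative_class0 => //.
  (* For each word [s], either the code omits [s] or the decoded sequence departs from [s] at some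
     [i < size s]; both are closed conditions by [closed_g]. *)
  rewrite (_ : [set x | _] = C n `&` \bigcap_(s in [set: seq bool])
      ([set x | C n x /\ g n x (phi (pickle s)) = false] `|`
       \big[setU/set0]_(i <- iota 0 (size s))
         [set x | C n x /\ g n x i = ~~ nth false s i])).
    apply: closedI => //; apply: closed_bigI => s _; apply: closedU => //.
    by apply: closed_bigsetU => i _.
  apply/seteqP; split => x /= [Cx].
    move=> nU; split => // s _ /=.
    have [gs|ngs] := eqVneq (mkseq (g n x) (size s)) s.
      left; split=> //; apply/negbTE/negP => gphi.
      by apply: nU; exists (size s); rewrite gs.
    right; rewrite -bigcup_seq /=.
    apply: contrapT => nex; move/eqP: ngs; apply.
    apply: (@eq_from_nth _ false); rewrite size_mkseq// => i si.
    rewrite nth_mkseq//; apply: contrapT => gi; apply: nex; exists i => /=.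
      by rewrite mem_iota.
    by split=> //; case: (g n x i) gi; case: nth.
  move=> sP; split=> // -[N gN].
  have [[_]|] := sP (mkseq (g n x) N) I; first by rewrite gN.
  rewrite -bigcup_seq size_mkseq => -[i /=]; rewrite mem_iota => iN [_].
  by rewrite nth_mkseq//; case: (g n x i).
Qed.

(** A set of additive class [b] is a countable union of complements of sets coded by relations
    [U (e m)] of lower index. A code interleaves the codes of these pieces: [m] gives the index, [k]
    separates pieces of equal index. *)
Lemma universal_at_step (b : W) (e : nat -> W)
    (U : W -> (nat -> bool) -> (nat -> bool) -> Prop) :
  (exists c, (c < b)%O) ->
  (forall c, (c < b)%O -> exists m, e m = c) ->
  (forall c, (c < b)%O -> universal_at c (U c)) ->
  universal_at b (fun c z => exists m k : nat,
    (e m < b)%O /\ ~ U (e m) (fun i => c (pickle (m, k, i))) z).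
Proof.
move=> b0 eb Ub.
have mulU m n phi : (e m < b)%O -> multiplicative_class (e m)
    [set x | C n x /\ ~ U (e m) (fun i => g n x (phi i)) (g n x)].
  by move=> /Ub[_ + _]; exact.
split=> [A addA|n phi|_ n phi].
- case: addA b0 eb Ub {mulU} => {b A} [b A bmin _|b c F cb mF] b0 eb Ub.
    by have [c cb] := b0; have := bmin c; rewrite cb.
  have /choice[D DP] : forall mk, exists u : nat -> bool, forall z,
      (e mk.1 < b)%O /\ ~ U (e mk.1) u z <-> e mk.1 = c mk.2 /\ F mk.2 (f z).
    move=> [m k] /=.
    have [emb|nemb] := boolP (e m < b)%O; last first.
      by exists (fun=> false) => z; split=> -[] // emc; rewrite emc cb in nemb.
    (* Slot [(m, k)] holds [F k] when [e m] is its index, and otherwise the empty set, so that it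
       adds nothing to the union. *)
    pose G := [set x | e m = c k /\ F k x].
    have mG : multiplicative_class (e m) G.
      have [emc|nemc] := eqVneq (e m) (c k).
        rewrite (_ : G = F k) ?emc//.
        by apply/seteqP; split => x //= [].
      rewrite (_ : G = set0); first exact: multiplicative_class_set0.
      by apply/seteqP; split => x //= [emc]; rewrite emc eqxx in nemc.
    have [/(_ _ (multiplicative_classC mG))[u uP] _ _] := Ub _ emb.
    exists u => z; rewrite -(uP z) /= notK; split; [by case|by split].
  exists (fun j => if unpickle j is Some (m, k, i) then D (m, k) i else false).
  move=> z.
  have subE m k : (fun i => if unpickle (pickle (m, k, i)) is Some (m, k, i)
                      then D (m, k) i else false) = D (m, k).
    by apply/funext => i; rewrite pickleK.
  split.
    move=> [k _ Fk]; have [m em] := eb _ (cb k); exists m, k; rewrite subE.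
    exact/(DP (m, k)).
  by move=> [m [k]]; rewrite subE => /(DP (m, k))[_ Fk]; exists k.
(* [C n] is replaced by its open supersets [V j], of least index. On [C n], failure of [U] means
   lying outside every [Q i], and each complement of [Q i] is of a lower additive class. *)
- have [V oV CV] := C_Gdelta n.
  have [c cb cmin] := below_minimal W_wf b0.
  pose Q (i : nat * nat) := [set x | C n x /\
    ~ U (e i.1) (fun j => g n x (phi (pickle (i.1, i.2, j)))) (g n x)].
  pose F (i : nat + nat * nat) := match i with
    | inl j => V j | inr i => ~` Q i end.
  rewrite (_ : [set x | _] = \bigcap_(i in
      [set i | if i is inr i then (e i.1 < b)%O else true]) F i).
    apply: (multiplicative_class_bigcap_lt W_wf) => // -[j _|i /= ib].
      by exists c => //; apply: additive_class0 => //; exact: oV.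
    exists (e i.1) => //; apply: multiplicative_classC.
    exact: (mulU _ n (fun j => phi (pickle (i.1, i.2, j)))).
  apply/seteqP; split => x /=.
    move=> [Cx nU] [j _|[m k] /= emb [_ nUm]] /=.
      by move: Cx; rewrite CV; exact.
    by apply: nU; exists m, k.
  move=> FP; have Cx : C n x by rewrite CV => j _; exact: (FP (inl j)).
  split=> // -[m [k [emb nUm]]]; exact: (FP (inr (m, k)) emb).
- rewrite (_ : [set x | _] = \bigcup_(i in [set i : nat * nat | (e i.1 < b)%O])
    [set x | C n x /\ ~ U (e i.1)
      (fun j => g n x (phi (pickle (i.1, i.2, j)))) (g n x)]).
    apply: (additive_class_bigcup_lt W_wf) => // -[m k] /= emb.
    exists (e m) => //.
    exact: (mulU _ n (fun j => phi (pickle (m, k, j)))).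
  apply/seteqP; split => x /=.
    by move=> [Cx [m [k [emb nU]]]]; exists (m, k).
  by move=> [[m k] emb [Cx nU]]; split => //; exists m, k.
Qed.

Lemma universal_at_exists (a : W) : countable [set b : W | (b < a)%O] ->
  forall b, (b <= a)%O -> exists U, universal_at b U.
Proof.
(* Either nothing lies below [a], and [b] is minimal, or a single enumeration [e] of the indices
   below [a] serves all stages of the induction. *)
move=> /pfcard_geP[a0 b ba|[e]].
  exists (fun c z => exists N, c (pickle (mkseq z N))).
  apply: universal_at_minimal => c; apply/negP => cb.
  suff : [set b : W | (b < a)%O] c by rewrite a0.
  exact: lt_le_trans ba.
elim/(well_founded_ind W_wf) => b IH ba.
have [b0|nb] := pselect (exists c, (c < b)%O); last first.
  eexists; apply: universal_at_minimal => c.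
  by apply/negP => cb; apply: nb; exists c.
have /choice[U UP] : forall c, exists U, (c < b)%O -> universal_at c U.
  move=> c; have [cb|ncb] := boolP (c < b)%O; last by exists (fun _ _ => True).
  by have [U Uc] := IH _ cb (le_trans (ltW cb) ba); exists U.
eexists; apply: (@universal_at_step _ e U) => // c cb.
have [m _ <-] : (e @` setT) c.
  by rewrite image_eq; exact: lt_le_trans ba.
by exists m.
Qed.

Hypothesis C_f : forall n z, C n (f z).
Hypothesis gK : forall n z, g n (f z) = z.

(** Every [g n] decodes [f c] to [c], so [E (f c)] amounts to [U c c]; a code [c] of the complement
    of [E] would make [U c c] equivalent to [~ E (f c)]. *)
Lemma additive_not_multiplicative (a : W) : (exists b, (b < a)%O) ->
  countable [set b : W | (b < a)%O] ->
  exists D : set (nat -> bool),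
    let E := [set x | exists2 n, C n x & D (g n x)] in
    additive_class a E /\ ~ multiplicative_class a E.
Proof.
move=> a0 ca; have [U [Uuniv _ Uadd]] := universal_at_exists ca (lexx a).
exists [set z | U z z] => E; split.
  rewrite (_ : E = \bigcup_n [set x | C n x /\ U (g n x) (g n x)]).
    apply: additive_class_bigcup => // n; exact: (Uadd a0 n id).
  by apply/seteqP; split => x [n]; [exists n|move=> _ []; exists n].
move=> /multiplicative_classC/Uuniv[c /(_ c) NE].
have EU : E (f c) <-> U c c.
  split=> [[n _ /=]|Ucc]; first by rewrite gK.
  by exists 0%N => //=; rewrite gK.
have NEE : ~ E (f c) <-> E (f c) := iff_trans NE (iff_sym EU).
tauto.
Qed.

End Universal.

(** * Closed sets of normed spaces and coordinates of [lp] *)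

Lemma closed_Gdelta (R : realType) (V : normedModType R) (C : set V) :
  closed C ->
  exists2 U : nat -> set V, forall j, open (U j) & C = \bigcap_j U j.
Proof.
(* A point in all these neighbourhoods of [C] is adherent to [C]. *)
move=> cC; exists (fun j => \bigcup_(y in C) ball y j.+1%:R^-1).
  by move=> j; apply: bigcup_open => y _; exact: ball_open.
apply/seteqP; split => [x Cx j _|x xU].
  by exists x => //; exact: ballxx.
apply: cC => B /nbhs_ballP[e /= e0 eB].
have [j je] : exists j, j.+1%:R^-1 < e.
  exists (Num.truncn e^-1); rewrite invf_plt ?posrE//.
  exact: truncnS_gt.
have [y Cy xy] := xU j I; exists y; split => //; apply: eB.
by apply: le_ball (ltW je) _ _; exact: ball_sym.
Qed.

Section Coordinates.
Context (R : realType) (p : R) (p1 : 1 <= p).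

Let p_gt0 : 0 < p. Proof. exact: lt_le_trans p1. Qed.

Lemma powR_coord_le_psum (x : nat -> R) n : ((`|x n| `^ p)%:E <= psum p x)%E.
Proof.
apply: (@le_trans _ _ (\sum_(0 <= i < n.+1) (`|x i| `^ p)%:E)%E).
  rewrite big_nat_recr//=; apply: leeDr; apply: sume_ge0 => k _.
  by rewrite lee_fin powR_ge0.
by apply: nneseries_lim_ge => k _ _; rewrite lee_fin powR_ge0.
Qed.

Lemma coord_le_norm (x : lp p1) n : `|x n| <= `|x|.
Proof.
have h : `|x n| `^ p <= fine (psum p x).
  by rewrite -lee_fin fineK ?psum_fin_num// powR_coord_le_psum.
have : (`|x n| `^ p) `^ p^-1 <= `|x|.
  apply: ge0_ler_powR => //; rewrite ?nnegrE ?powR_ge0 ?invr_ge0 ?(ltW p_gt0)//.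
  by rewrite fine_ge0 ?psum_ge0.
by rewrite -powRrM mulfV ?gt_eqF// powRr1.
Qed.

Lemma continuous_coord n : continuous (fun x : lp p1 => x n).
Proof.
move=> x A /nbhs_ballP[e /= e0 eA]; apply/(@nbhs_ballP R (lp p1)).
exists e => // y; rewrite -ball_normE /= => xy; apply: eA.
rewrite -ball_normE /=; apply: le_lt_trans xy.
exact: (coord_le_norm (x - y)).
Qed.

Lemma closed_coord n a : closed [set x : lp p1 | x n = a].
Proof.
apply: (closed_comp (f := fun x : lp p1 => x n) (D := [set a])).
  by move=> x _; exact: continuous_coord.
exact: closed_eq.
Qed.

Lemma lp_norm_lt (x : lp p1) e : 0 < e ->
  (psum p x < (e `^ p)%:E)%E -> `|x| < e.
Proof.
move=> e0 xe.
have h : fine (psum p x) < e `^ p by rewrite -lte_fin fineK ?psum_fin_num.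
have -> : e = (e `^ p) `^ p^-1.
  by rewrite -powRrM mulfV ?gt_eqF// powRr1 ?ltW.
apply: gt0_ltr_powR => //; rewrite ?nnegrE ?powR_ge0 ?invr_gt0//.
by rewrite fine_ge0 ?psum_ge0.
Qed.

End Coordinates.

(** * Coding binary sequences by points of [lp] *)

Section Coding.
Context (R : realType) (p : R) (p1 : 1 <= p).

Let p_gt0 : 0 < p. Proof. exact: lt_le_trans p1. Qed.

Definition weight (n : nat) : R := (2 ^ n.+1)%:R^-1.

Lemma weight_gt0 n : 0 < weight n.
Proof. by rewrite invr_gt0 ltr0n expn_gt0. Qed.

Lemma psum_weight : (psum p weight <= 1)%E.
Proof.
apply: le_trans (epsilon_trick0 xpredT ler01).
apply: lee_nneseries => n *; rewrite lee_fin ?powR_ge0//.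
rewrite div1r gtr0_norm ?weight_gt0// ge1r_powR// weight_gt0 /=.
by rewrite invf_le1 ?ltr0n ?expn_gt0// ler1n expn_gt0.
Qed.

(* Coordinate [m] carries the digit [digit m] of the code, so that every digit
   is repeated infinitely often; [digit_pos n i] is a coordinate beyond [n]
   carrying digit [i]. *)
Definition digit (m : nat) : nat := logn 2 m.+1.

Definition digit_pos (n i : nat) : nat := (2 ^ i * n.*2.+1).-1.

(** [digit m] is the 2-adic valuation of [m + 1], and [digit_pos n i + 1] is [2 ^ i] times an odd
    number. *)
Lemma digit_posK n i : digit (digit_pos n i) = i.
Proof.
rewrite /digit prednK ?muln_gt0 ?expn_gt0// lognM ?expn_gt0// pfactorK//.
by rewrite logn_coprime ?addn0// coprime2n /= odd_double.
Qed.

Lemma leq_digit_pos n i : (n <= digit_pos n i)%N.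
Proof.
rewrite /digit_pos -ltnS prednK ?muln_gt0 ?expn_gt0//.
apply: (@leq_trans n.*2.+1); last by rewrite leq_pmull ?expn_gt0.
by rewrite ltnS -addnn leq_addr.
Qed.

Lemma digit_le m : (digit m <= m)%N.
Proof. by rewrite -ltnS; exact: ltn_logl. Qed.

Definition code_seq (z : nat -> bool) (m : nat) : R :=
  if z (digit m) then weight m else 0.

Lemma norm_code_seq z m : `|code_seq z m| <= weight m.
Proof.
rewrite /code_seq; case: ifP => _; last by rewrite normr0 ltW ?weight_gt0.
by rewrite gtr0_norm ?weight_gt0.
Qed.

Lemma code_seq_psummable z : code_seq z \in psummable p.
Proof.
apply/mem_set => /=; apply: le_lt_trans (ltry 1); apply: le_trans psum_weight.
apply: lee_nneseries => n *; rewrite lee_fin ?powR_ge0//.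
rewrite ge0_ler_powR ?nnegrE// ?(ltW p_gt0)//.
by rewrite (le_trans (norm_code_seq z n))// ler_norm.
Qed.

Definition code_point z : lp p1 := Lp p1 (code_seq_psummable z).

(** Since [digit k <= k], equal prefixes of length [N] give equal coordinates before [N]; from [N]
    on the difference is bounded by the weights, whose tail is small. *)
Lemma code_point_continuous (A : set (lp p1)) z : open A -> A (code_point z) ->
  exists N, forall z', mkseq z' N = mkseq z N -> A (code_point z').
Proof.
move=> oA Az; have /nbhs_ballP[e /= e0 eA] := open_nbhs_nbhs (conj oA Az).
have tail : (\sum_(N <= k <oo) (`|weight k| `^ p)%:E)%E @[N --> \oo] --> 0%E.
  apply: nneseries_tail_cvg; last by move=> k _; rewrite lee_fin powR_ge0.
  exact: le_lt_trans psum_weight (ltry 1).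
have /tail[N _ /(_ N (leqnn N)) /= wN] : nbhs 0%E [set t | t < (e `^ p)%:E]%E.
  by apply: open_ereal_lt'; rewrite lte_fin powR_gt0.
exists N => z' zN; apply: eA; rewrite -ball_normE /=.
apply: lp_norm_lt => //; apply: le_lt_trans wN.
have subE k : (code_point z - code_point z') k = code_seq z k - code_seq z' k.
  by [].
rewrite /psum (nneseries_split 0 N); last first.
  by move=> k _; rewrite lee_fin powR_ge0.
rewrite add0n big1_seq ?add0e => [|k].
  apply: lee_nneseries => k *; rewrite lee_fin ?powR_ge0//.
  rewrite ge0_ler_powR ?nnegrE// ?(ltW p_gt0)// subE /code_seq.
  by case: ifP => _; case: ifP => _;
    rewrite ?subrr ?subr0 ?sub0r ?normrN ?normr0.
rewrite mem_index_iota => /andP[_ /andP[_ kN]].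
have zz : z' (digit k) = z (digit k).
  have dN : (digit k < N)%N := leq_ltn_trans (digit_le k) kN.
  by move: (congr1 (nth false ^~ (digit k)) zN); rewrite !nth_mkseq.
by rewrite subE /code_seq zz subrr normr0 powR0 ?gt_eqF.
Qed.

Definition decode (n : nat) (x : lp p1) (i : nat) : bool :=
  x (digit_pos n i) != 0.

(** Naming the code as [decode n x], the only possible one by [code_tail_decode], avoids quantifying
    over codes. *)
Definition code_tail (n : nat) : set (lp p1) :=
  [set x : lp p1 | forall m, (n <= m)%N -> x m = code_seq (decode n x) m].

Lemma code_tail_decode n (x : lp p1) z :
  (forall m, (n <= m)%N -> x m = code_seq z m) ->
  code_tail n x /\ decode n x = z.
Proof.
move=> xz; have zE : decode n x = z.
  apply/funext => i; rewrite /decode xz ?leq_digit_pos// /code_seq digit_posK.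
  by case: ifP; rewrite ?eqxx// gt_eqF ?weight_gt0.
by split=> // m nm; rewrite zE xz.
Qed.

(** On [code_tail n] a coordinate is either 0 or its weight, which turns the open condition of being
    nonzero into a closed equation. *)
Lemma decode_coord n (x : lp p1) i v : code_tail n x ->
  (decode n x i = v) <->
  (x (digit_pos n i) = if v then weight (digit_pos n i) else 0).
Proof.
move=> Cx; have := Cx _ (leq_digit_pos n i); rewrite /code_seq digit_posK => xE.
split=> [<-//|]; rewrite /decode => ->.
by case: v; rewrite ?eqxx// gt_eqF ?weight_gt0.
Qed.

Lemma closed_code_tail n : closed (code_tail n).
Proof.
pose P (v : bool) k := [set x : lp p1 | x k = if v then weight k else 0].
(* Coordinate [m] and the coordinate where its digit is read both carry their weights or both
   vanish. *)
rewrite (_ : code_tail n = \bigcap_(m in [set m | (n <= m)%N])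
    (P true (digit_pos n (digit m)) `&` P true m `|`
     P false (digit_pos n (digit m)) `&` P false m)).
  apply: closed_bigI => m _; apply: closedU; apply: closedI;
  exact: closed_coord.
apply/seteqP; split => [x Cx m nm|x xP m nm].
  have := Cx m nm; rewrite /code_seq.
  by case: ifP => /(decode_coord _ _ Cx) ds xm; [left|right].
rewrite /code_seq /decode.
by have [[-> ->]|[-> ->]] := xP m nm; rewrite ?eqxx// gt_eqF ?weight_gt0.
Qed.

Lemma closed_decode n i v :
  closed [set x : lp p1 | code_tail n x /\ decode n x i = v].
Proof.
rewrite (_ : [set x | _] = code_tail n `&`
  [set x : lp p1 | x (digit_pos n i) =
    if v then weight (digit_pos n i) else 0]).
  by apply: closedI; [exact: closed_code_tail|exact: closed_coord].
by apply/seteqP; split => x /= [Cx] /(decode_coord _ _ Cx).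
Qed.

End Coding.

Theorem lemma3p1 (d : Order.disp_t) (W : orderType d)
  (W_wf : well_founded (fun b c : W => (b < c)%O))
  (alpha : W) (alpha_countable : countable [set b : W | (b < alpha)%O])
  (alpha_ge1 : exists b : W, (b < alpha)%O)
  (R : realType) (p : R) (p1 : 1 <= p) :
  exists E : set (lp p1),
    [/\ S_open E, additive_class alpha E & ~ multiplicative_class alpha E].
Proof.
have fK n z : code_tail n (code_point p1 z) /\ decode n (code_point p1 z) = z.
  exact: code_tail_decode.
have [D [addE multE]] := additive_not_multiplicative W_wf
  (@code_point_continuous R p p1)
  (fun n => closed_Gdelta (@closed_code_tail R p p1 n))
  (@closed_decode R p p1) (fun n z => (fK n z).1) (fun n z => (fK n z).2)
  alpha_ge1 alpha_countable.
eexists; split; [|exact: addE|exact: multE].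
(* Beyond both [n] and the changed coordinate [k], [y] agrees with the same code point as [x], hence
   decodes to the same element of [D]. *)
move=> x y [n Cx Dx] [k yx]; exists (maxn n k.+1).
  apply: (code_tail_decode (z := decode n x) _).1 => m.
  by rewrite geq_max => /andP[nm km]; rewrite yx ?gtn_eqF// Cx.
rewrite (code_tail_decode (z := decode n x) _).2// => m.
by rewrite geq_max => /andP[nm km]; rewrite yx ?gtn_eqF// Cx.
Qed.
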